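(* Let $\alpha\in(0,1]$, let the active family be fixed, $I_t=[m]=\{1,\dots,m\}$ for all $t$, and for each $i\in[m]$ let $M_i=(M_{i,t})_{t\ge0}$ be a global $e$-process for $H_i$. Let $A:[1,\infty]\to[0,\infty]$ be a nondecreasing function (adjuster) with $\int_1^\infty A(x)x^{-2}\,dx\le1$ and set $$\widetilde M_{i,t}=A\Big(1\vee\sup_{0\le u\le t}M_{i,u}\Big),\qquad \widetilde E_t^{S}=\frac1{|S|}\sum_{i\in S}\widetilde M_{i,t}\quad(\varnothing\ne S\subseteq[m]).$$ Then the closed-eBH candidate family $$\mathfrak R_{t}=\{R\subseteq[m]:\ \mathrm{FDP}_S(R)\le\alpha\widetilde E_t^{S}\text{ for every nonempty }S\subseteq[m]\}$$ is setwise persistent (pointwise on $\Omega$, $\mathfrak R_t\subseteq\mathfrak R_u$ for $t\le u$) and controls simultaneous SupFDR at level $\alpha$: for every $P\in\mathcal M$, $\mathbb E_P[\sup_{t\ge0}\max_{R\in\mathfrak R_t}\mathrm{FDP}_{\mathcal N(P)}(R)]\le\alpha$. At every time $t$, $\mathfrak R_t$ contains the rejection set of the ordinary eBH procedure at level $\alpha$ applied to the adjusted coordinates $\widetilde M_{1,t},\dots,\widetilde M_{m,t}$.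
   Context: Let $(\Omega,\mathcal F,(\mathcal F_t)_{t\in\mathbb N_0})$ be a discrete-time filtered measurable space, $\mathcal M$ a family of probability measures on $(\Omega,\mathcal F)$, and $H_i\subseteq\mathcal M$, $i\in[m]$, null hypotheses. Put $\mathcal N(P)=\{i\in[m]:P\in H_i\}$. For $R,S\subseteq[m]$, $\mathrm{FDP}_S(R)=|S\cap R|/(|R|\vee 1)$. No assumption is made on the dependence among the $M_i$. A nonnegative $(\mathcal F_t)$-adapted process $E=(E_t)_{t\ge0}$ is a (global) $e$-process for $H\subseteq\mathcal M$ if $\mathbb E_P[E_\tau]\le1$ for every $P\in H$ and every $(\mathcal F_t)$-stopping time $\tau$ with $P(\tau<\infty)=1$. The ordinary eBH procedure at level $\alpha$ applied to values $e_1,\dots,e_m\ge0$: with $e_{[k]}$ the $k$-th largest value, let $k^*$ be the largest $k\in\{1,\dots,m\}$ with $k\,e_{[k]}/m\ge1/\alpha$ and reject the $k^*$ hypotheses with the largest values; if no such $k$ exists, reject nothing. *)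

(* Defs.v *)
From HB Require Import structures.
From mathcomp Require Export all_boot all_order all_algebra.
From mathcomp Require Export all_classical all_reals all_analysis.
From mathcomp Require Export measurable_realfun.
Export Order.TTheory GRing.Theory Num.Theory.
Export numFieldNormedType.Exports.

Set Implicit Arguments.
Unset Strict Implicit.
Unset Printing Implicit Defensive.

Local Open Scope classical_set_scope.
Local Open Scope ring_scope.
Local Open Scope ereal_scope.

Definition filtration {d : measure_display} {T : measurableType d}
    (F : nat -> set (set T)) : Prop :=
  [/\ forall t, sigma_algebra [set: T] (F t),
      forall t, F t `<=` measurable
    & forall t u, (t <= u)%N -> F t `<=` F u].

Definition adapted {d : measure_display} {T : measurableType d} {R : realType}
    (F : nat -> set (set T)) (E : nat -> T -> \bar R) : Prop :=
  forall t (B : set (\bar R)), measurable B -> F t (E t @^-1` B).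

(* The value [None] stands for an infinite time. *)
Definition stopping_time {d : measure_display} {T : measurableType d}
    (F : nat -> set (set T)) (tau : T -> option nat) : Prop :=
  forall t : nat, F t [set w | exists2 s : nat, (s <= t)%N & tau w = Some s].

(* The value 0 on [tau = None] is immaterial: [e_process] only evaluates this
   at stopping times that are almost surely finite. *)
Definition stopped {T : Type} {R : realType}
    (E : nat -> T -> \bar R) (tau : T -> option nat) (w : T) : \bar R :=
  if tau w is Some t then E t w else 0.

Definition e_process {d : measure_display} {T : measurableType d} {R : realType}
    (F : nat -> set (set T)) (H : set (probability T R))
    (E : nat -> T -> \bar R) : Prop :=
  [/\ forall t w, 0 <= E t w,
      adapted F E
    & forall P : probability T R, H P ->
      forall tau : T -> option nat, stopping_time F tau ->
        P [set w | exists t : nat, tau w = Some t] = 1 ->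
        \int[P]_w stopped E tau w <= 1].

(* Only the values of [A] on [1, +oo] are constrained (and used). *)
Definition adjuster {R : realType} (A : \bar R -> \bar R) : Prop :=
  [/\ forall x, 1 <= x -> 0 <= A x,
      forall x y, 1 <= x -> x <= y -> A x <= A y
    & \int[lebesgue_measure]_(x in `[1%R, +oo[) (A x%:E * (x ^- 2)%:E) <= 1].

Definition adjusted {T : Type} {R : realType} (A : \bar R -> \bar R)
    (E : nat -> T -> \bar R) (t : nat) (w : T) : \bar R :=
  A (maxe 1 (ereal_sup [set E u w | u in [set u : nat | (u <= t)%N]])).

Definition avg_evalue {R : realType} {m : nat} (e : 'I_m -> \bar R)
    (S : {set 'I_m}) : \bar R :=
  (#|S|%:R^-1)%:E * \sum_(i in S) e i.

Definition FDP {R : realType} {m : nat} (S D : {set 'I_m}) : R :=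
  (#|S :&: D|%:R / (maxn #|D| 1)%:R)%R.

Definition true_nulls {d : measure_display} {T : measurableType d}
    {R : realType} {m : nat} (H : 'I_m -> set (probability T R))
    (P : probability T R) : {set 'I_m} :=
  finset (fun i : 'I_m => `[< H i P >]).

Definition closed_eBH {R : realType} {m : nat} (alpha : R)
    (e : 'I_m -> \bar R) : {set {set 'I_m}} :=
  finset (fun D : {set 'I_m} => [forall S : {set 'I_m},
    (S != finset.set0) ==> ((FDP S D)%:E <= alpha%:E * avg_evalue e S)]).

(* The default value 0 of the maximum is harmless: FDP is nonnegative, and the
   families considered always contain the empty set. *)
Definition max_FDP {R : realType} {m : nat} (S : {set 'I_m})
    (C : {set {set 'I_m}}) : R :=
  \big[Order.max/0%R]_(D in C) FDP S D.

Definition simultaneous_SupFDR {d : measure_display} {T : measurableType d}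
    {R : realType} {m : nat} (H : 'I_m -> set (probability T R))
    (C : nat -> T -> {set {set 'I_m}}) (P : probability T R) : \bar R :=
  \int[P]_w ereal_sup (range (fun t : nat =>
    (max_FDP (true_nulls H P) (C t w))%:E)).

Definition setwise_persistent {T : Type} {m : nat}
    (C : nat -> T -> {set {set 'I_m}}) : Prop :=
  forall (w : T) (t u : nat), (t <= u)%N -> C t w \subset C u w.

Definition kth_largest {R : realType} {m : nat} (e : 'I_m -> \bar R)
    (k : nat) : \bar R :=
  nth 0 (sort (fun x y : \bar R => y <= x) [seq e i | i <- enum 'I_m]) k.-1.

(* Equal to 0 when no index satisfies the condition. *)
Definition eBH_count {R : realType} {m : nat} (alpha : R)
    (e : 'I_m -> \bar R) : nat :=
  \max_(k < m.+1 | (0 < k)%N &&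
      ((alpha^-1)%:E <= (k%:R / m%:R)%:E * kth_largest e k)) k.

(* The order in which ties are listed is irrelevant: by maximality of
   [eBH_count], the last selected value is strictly above the next one. *)
Definition eBH {R : realType} {m : nat} (alpha : R) (e : 'I_m -> \bar R) :
    {set 'I_m} :=
  finset (fun i : 'I_m => i \in
    take (eBH_count alpha e) (sort (fun i j => e j <= e i) (enum 'I_m))).

(* Main.v *)
Require Import Defs.
From mathcomp Require Import ring.

Set Implicit Arguments.
Unset Strict Implicit.
Unset Printing Implicit Defensive.

Local Open Scope classical_set_scope.
Local Open Scope ring_scope.

(** Only the bound on SupFDR is probabilistic. The adjusted coordinates are
    nondecreasing in time, so closed eBH accepts more and more candidate sets
    (persistence), and every candidate set accepted at any time [t] has
    [FDP_N <= alpha * avg_(i in N) A (1 \/ sup_u M_(i,u))], where [N] is the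
    set of true nulls and the supremum now runs over the whole time axis. The
    right-hand side does not depend on [t], hence it also bounds the supremum
    over time, and it is enough that each [A (1 \/ sup_u M_(i,u))] has
    expectation at most 1 (expectation_adjusted_sup_le1). This holds whatever
    the dependence among the [M_i], by linearity of the expectation.

    The expectation bound rests on Ville's inequality
    [P (sup_u M_u >= c) <= 1 / c] (ville): stop at the first passage above [c],
    or at a finite horizon if there is none. In other words, [1 \/ sup_u M_u]
    is stochastically dominated by the Pareto law with density [x ^- 2] on
    [1, +oo[. The expectation of a nondecreasing function can only grow under
    stochastic domination, and the expectation of [A] under the Pareto law is
    the integral that an adjuster keeps below 1 (le_expectation_pareto). This
    comparison is done one superlevel set of [A] at a time, after rewriting
    both expectations with the layer-cake formula (weighted_layer_cake).

    That closed eBH accepts the eBH rejection set (eBH_in_closed_eBH) is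
    counting: each of the [k] rejected values is at least [m / (k alpha)], so
    the average over [S] is at least
    [#|S :&: D| * m / (k * alpha * #|S|) >= FDP_S(D) / alpha]. *)

(** * Monotonicity of the integral *)

Section le_integral.
Local Open Scope ereal_scope.

(** The integral of a nonnegative function is a supremum over the simple
    functions below it, so it is monotone for arbitrary functions; stopped
    processes and suprema of FDPs are bounded directly in this way. *)
Lemma ge0_le_integral_nomeas (d : measure_display) (T : measurableType d)
    (R : realType) (mu : {measure set T -> \bar R}) (D : set T)
    (f g : T -> \bar R) :
  (forall x, D x -> 0 <= f x) -> (forall x, D x -> f x <= g x) ->
  \int[mu]_(x in D) f x <= \int[mu]_(x in D) g x.
Proof.
move=> f0 fg; rewrite !ge0_integralE//; last first.
  by move=> x Dx; exact: le_trans (f0 x Dx) (fg x Dx).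
apply: ereal_sup_le => _ [h hf <-]; exists h => // x.
exact: le_trans (hf x) (lee_restrict fg x).
Qed.

End le_integral.

(** * Ville's inequality for e-processes *)

Section ville.
Local Open Scope ereal_scope.

Lemma find_iota_leP (a : pred nat) (t s : nat) : (s < t)%N ->
  reflect (exists2 u, (u <= s)%N & a u) (find a (iota 0 t) <= s)%N.
Proof.
move=> st; apply: (iffP idP) => [fs|[u us au]].
  have ft : (find a (iota 0 t) < t)%N by exact: leq_ltn_trans st.
  exists (find a (iota 0 t)) => //.
  have /(nth_find 0%N) : has a (iota 0 t) by rewrite has_find size_iota.
  by rewrite nth_iota.
rewrite leqNgt; apply/negP => sf.
have /(before_find 0%N) : (u < find a (iota 0 t))%N by exact: leq_ltn_trans sf.
by rewrite nth_iota ?add0n ?au//; exact: leq_ltn_trans st.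
Qed.

Lemma sigma_algebra_ex (T : Type) (G : set (set T)) (B : nat -> set T)
    (s : nat) :
  sigma_algebra [set: T] G -> (forall u, (u <= s)%N -> G (B u)) ->
  G [set w | exists2 u, (u <= s)%N & B u w].
Proof.
move=> [G0 _ GU] GB.
have -> : [set w | exists2 u, (u <= s)%N & B u w] =
    \bigcup_u (if (u <= s)%N then B u else set0).
  apply/seteqP; split=> [w [u us Buw]|w [u _]]; first by exists u; rewrite ?us.
  by case: ifP => // us Buw; exists u.
by apply: GU => u; case: ifP => [/GB|].
Qed.

(** The first passage above [c] strictly before [t], or [t] if there is none:
    [find] returns the length of the list when the search fails. The cap at
    [t] keeps the stopping time finite everywhere. *)
Definition passage_or (T : Type) (R : realType) (E : nat -> T -> \bar R)
    (c : \bar R) (t : nat) (w : T) : nat :=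
  find (fun u => c < E u w) (iota 0 t).

Context (d : measure_display) (T : measurableType d) (R : realType).
Variables (F : nat -> set (set T)) (H : set (probability T R)).
Variable E : nat -> T -> \bar R.
Hypothesis hF : filtration F.
Hypothesis hE : e_process F H E.

Lemma measurable_e_process t : measurable_fun setT (E t).
Proof.
case: hE hF => _ aE _ [_ FM _] _ B mB; rewrite setTI.
exact/(FM t)/aE.
Qed.

Lemma measurable_sup_e_process :
  measurable_fun setT (fun w => ereal_sup (range (E ^~ w))).
Proof.
rewrite (_ : (fun w => _) = fun w => esups (E ^~ w) 0%N).
  exact/measurable_fun_esups/measurable_e_process.
apply/funext => w; congr ereal_sup.
by apply/seteqP; split=> [_ [t _ <-]|_ [t _ <-]]; exists t.
Qed.

Lemma stopping_time_passage_or c t :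
  stopping_time F (fun w => Some (passage_or E c t w)).
Proof.
case: hE hF => _ aE _ [Fs _ Fle] s.
have [G0 GC _] := Fs s.
have [ts|st] := leqP t s.
  (* After the cap, the event is certain. *)
  rewrite (_ : [set _ | _] = setT `\` set0); first exact: GC.
  apply/seteqP; split=> [w _|w _]; first by split.
  exists (passage_or E c t w) => //.
  by rewrite (leq_trans _ ts)// -[leqRHS](size_iota 0 t) find_size.
rewrite (_ : [set _ | _] = [set w | exists2 u, (u <= s)%N & c < E u w]).
  apply: (sigma_algebra_ex (B := fun u => [set w | c < E u w])) => // u us.
  apply: (Fle u) => //.
  by rewrite -preimage_itvoy; exact/aE/emeasurable_itv.
apply/seteqP; split=> [w [v vs [passv]]|w /(find_iota_leP _ st) fs].
  by apply/(find_iota_leP _ st); rewrite -passv in vs.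
by exists (passage_or E c t w).
Qed.

Lemma measurable_passage_before c t :
  measurable [set w | exists2 u, (u < t)%N & c < E u w].
Proof.
rewrite (_ : [set w | _] = \bigcup_(u in `I_t) [set w | c < E u w]).
  apply: bigcup_measurable => u _; rewrite -[X in measurable X]setTI.
  by apply: emeasurable_fun_o_infty => //; exact: measurable_e_process.
by apply/seteqP; split=> [w [u]|w [u]]; exists u.
Qed.

(** Markov's inequality for the process stopped at the capped first passage: on
    the event, the stopped value exceeds [c]. *)
Lemma ville_finite_horizon (P : probability T R) (c : R) (t : nat) :
  H P -> (0 < c)%R ->
  c%:E * P [set w | exists2 u, (u < t)%N & c%:E < E u w] <= 1.
Proof.
case: (hE) => E0 _ hint HP c0.
set B := [set w | _].
have mB : measurable B by exact: measurable_passage_before.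
have := hint P HP _ (stopping_time_passage_or c%:E t).
rewrite (_ : [set _ | _] = setT); last first.
  by apply/seteqP; split=> // w _; exists (passage_or E c%:E t w).
rewrite probability_setT => /(_ erefl); apply: le_trans.
rewrite -[B in P B]setIT -integral_indic// -ge0_integralZl_EFin//; last 2 first.
- by apply/measurable_EFinP; exact: measurable_indic.
- exact: ltW.
apply: ge0_le_integral_nomeas => w _.
  by apply: mule_ge0; rewrite lee_fin ?(ltW c0)// indicE ler0n.
rewrite /= indicE; have [wB|_] := boolP (w \in B); last first.
  by rewrite mule0; exact: E0.
rewrite mule1 /passage_or.
move: wB; rewrite inE => -[u ut cEu].
have /(nth_find 0%N) : has (fun u => c%:E < E u w) (iota 0 t).
  by apply/hasP; exists u => //; rewrite mem_iota.
rewrite nth_iota ?add0n; first exact: ltW.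
rewrite -[ltnRHS](size_iota 0 t) -has_find.
by apply/hasP; exists u => //; rewrite mem_iota.
Qed.

(** The event that [c] is exceeded at some time is the increasing union of the
    finite-horizon events. *)
Lemma ville_lt (P : probability T R) (c : R) :
  H P -> (0 < c)%R ->
  P [set w | c%:E < ereal_sup (range (E ^~ w))] <= c^-1%:E.
Proof.
move=> HP c0.
pose B t := [set w | exists2 u, (u < t)%N & c%:E < E u w].
have mB t : measurable (B t) by exact: measurable_passage_before.
rewrite (_ : [set w | _] = \bigcup_t B t); last first.
  apply/seteqP; split=> [w /ereal_sup_gt[_ [u _ <-] cu]|w [t _ [u ut cu]]].
    by exists u.+1 => //; exists u.
  by apply: lt_le_trans cu _; apply: ereal_sup_ubound; exists u.
have BP : P \o B @ \oo --> P (\bigcup_t B t).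
  apply: nondecreasing_cvg_mu => //; first exact: bigcup_measurable.
  move=> s t st; apply/subsetPset => w [u us cu]; exists u => //.
  exact: leq_trans st.
rewrite -(cvg_lim _ BP)//; apply: lime_le; first exact: cvgP BP.
apply: nearW => t /=.
by rewrite -[c^-1%:E]mule1 lee_pdivlMl// ville_finite_horizon.
Qed.

(** The supremum can equal [c] although the process never exceeds [c]; the
    strict version is therefore used at levels increasing to [c], chosen so
    that their inverses are [c^-1 + e]. *)
Lemma ville (P : probability T R) (c : R) :
  H P -> (0 < c)%R ->
  P [set w | c%:E <= ereal_sup (range (E ^~ w))] <= c^-1%:E.
Proof.
move=> HP c0; apply/lee_addgt0Pr => e e0.
have c'0 : (0 < (c^-1 + e)^-1)%R by rewrite invr_gt0 addr_gt0// invr_gt0.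
rewrite -EFinD -[(c^-1 + e)%R]invrK; apply: le_trans (ville_lt HP c'0).
have mS : measurable_fun setT (fun w => ereal_sup (range (E ^~ w))).
  exact: measurable_sup_e_process.
apply: le_measure; rewrite ?inE.
- by rewrite -[X in measurable X]setTI; exact: emeasurable_fun_c_infty.
- by rewrite -[X in measurable X]setTI; exact: emeasurable_fun_o_infty.
move=> w /=; apply: lt_le_trans; rewrite lte_fin.
by rewrite invf_plt ?posrE ?addr_gt0 ?invr_gt0// ltrDl.
Qed.

End ville.

(** * Layer-cake formula *)

Section layer_cake.
Local Open Scope ereal_scope.

Lemma lebesgue_measure_hypograph_section (R : realType) (y : \bar R) :
  0 <= y -> lebesgue_measure [set s : R | (0 <= s)%R && (s%:E < y)] = y.
Proof.
case: y => [r||//]; rewrite ?lee_fin => r0.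
- rewrite (_ : [set s | _] = `[0%R, r[%classic); last first.
    by apply/seteqP; split=> s /=; rewrite in_itv/= lte_fin.
  rewrite lebesgue_measure_itv/= lte_fin sube0.
  by case: ltgtP r0 => // <-.
- rewrite (_ : [set s | _] = `[0%R, +oo[%classic); last first.
    by apply/seteqP; split=> s /=; rewrite in_itv/= ltry.
  by rewrite lebesgue_measure_itv/= ltry.
Qed.

(** Write [f x] as the length of [{s | 0 <= s < f x}] and exchange the two
    integrals by Tonelli's theorem. The weight [g] lets the formula apply both
    to an expectation, with [g = 1], and to an integral against a density. *)
Lemma weighted_layer_cake (d : measure_display) (T : measurableType d)
    (R : realType) (mu : {sigma_finite_measure set T -> \bar R})
    (f g : T -> \bar R) :
  measurable_fun setT f -> measurable_fun setT g ->
  (forall x, 0 <= f x) -> (forall x, 0 <= g x) ->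
  \int[mu]_x (f x * g x) =
  \int[lebesgue_measure]_(s in `[0%R, +oo[)
    \int[mu]_(x in [set x | s%:E < f x]) g x.
Proof.
move=> mf mg f0 g0.
pose D : set (T * measurableTypeR R) :=
  [set p | (0 <= p.2)%R && (p.2%:E < f p.1)].
have mD : measurable D.
  have -> : D = [set p | 0 <= p.2%:E] `&` [set p | p.2%:E < f p.1].
    by apply/seteqP; split=> p /=; rewrite lee_fin => /andP.
  have m2 := measurableT_comp (@EFin_measurable R setT)
    (@measurable_snd _ _ T (measurableTypeR R)).
  apply: measurableI; rewrite -[X in measurable X]setTI.
    exact: emeasurable_fun_c_infty.
  apply: measurable_lte => //.
  by apply: measurableT_comp mf _; exact: measurable_fst.
have h0 p : 0 <= g p.1 * (\1_D p)%:E by rewrite mule_ge0// lee_fin indicE.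
transitivity (\int[mu]_x \int[lebesgue_measure]_(s in setT)
    (g (x, s).1 * (\1_D ((x, s) : T * measurableTypeR R))%:E)).
  apply: eq_integral => x _ /=; rewrite muleC.
  pose Dx : set R := [set s | (0 <= s)%R && (s%:E < f x)].
  have DxE : Dx = xsection D x.
    by apply/seteqP; split=> s; rewrite /xsection/= inE.
  have mDx : measurable Dx by rewrite DxE; exact: measurable_xsection.
  transitivity (\int[lebesgue_measure]_s (g x * (\1_Dx s)%:E)).
    rewrite ge0_integralZl//=.
    - rewrite integral_indic// setIT; congr (_ * _).
      exact/esym/lebesgue_measure_hypograph_section.
    - by apply/measurable_EFinP; exact: measurable_indic.
  by apply: eq_integral => s _; rewrite DxE !indicE/= mem_xsection.
rewrite (fubini_tonelli (fun p : T * measurableTypeR R =>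
  g p.1 * (\1_D p)%:E))//=; last first.
  apply: emeasurable_funM.
    by apply: measurableT_comp mg _; exact: measurable_fst.
  by apply/measurable_EFinP; exact: measurable_indic.
rewrite [RHS]integral_mkcond; apply: eq_integral => s _.
rewrite patchE; case: ifPn; rewrite ?inE ?notin_setE/= in_itv/= andbT => s0.
  rewrite [RHS]integral_mkcond; apply: eq_integral => x _.
  rewrite patchE indicE; case: ifPn => xs.
    by rewrite mem_set ?mule1// /D/= s0; move: xs; rewrite inE.
  rewrite memNset ?mule0// /D/= s0/=; apply/negP.
  by move: xs; rewrite notin_setE/=; apply: contra_notN.
apply: integral0_eq => x _; rewrite indicE memNset ?mule0// /D/=.
by move=> /andP[s0' _]; exact: s0.
Qed.

End layer_cake.

(** * Comparison with the Pareto law *)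

Section pareto.
Local Open Scope ereal_scope.

(** A superlevel set of a nondecreasing function is an up-set, hence an
    interval starting at its infimum, closed or open depending on whether it
    contains that infimum. *)
Lemma measurable_monotone_level (R : realType) (B : \bar R -> \bar R)
    (s : \bar R) :
  {homo B : x y / x <= y} -> measurable [set x | s < B x].
Proof.
move=> ndB; set U := [set x | _]; set c := ereal_inf U.
have upU x y : x <= y -> U x -> U y.
  by move=> xy; rewrite /U/= => /lt_le_trans; apply; exact: ndB.
have [Uc|Uc] := pselect (U c).
  rewrite (_ : U = `[c, +oo[%classic); first exact: emeasurable_itv.
  apply/seteqP; split=> x /=; rewrite in_itv/= ?andbT.
    by move=> Ux; exact: ereal_inf_lbound.
  by move=> cx; exact: upU Uc.
rewrite (_ : U = `]c, +oo[%classic); first exact: emeasurable_itv.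
apply/seteqP; split=> x /=; rewrite in_itv/= ?andbT.
  move=> Ux; rewrite lt_neqAle ereal_inf_lbound// andbT.
  by apply/eqP => cx; apply: Uc; rewrite cx.
by move=> /ereal_inf_lt[y Uy yx]; apply: upU Uy; exact: ltW.
Qed.

Lemma measurable_monotone (R : realType) (B : \bar R -> \bar R) :
  {homo B : x y / x <= y} -> measurable_fun setT B.
Proof.
move=> ndB _; apply: (measurability _ (ErealGenOInfty.measurableE R)) => //.
move=> _ [_ [r ->] <-]; rewrite setTI preimage_itvoy.
exact: measurable_monotone_level.
Qed.

Lemma within_continuous_exprV2 (R : realType) (r : R) : (0 < r)%R ->
  {within `[r, +oo[, continuous (fun x : R => x ^- 2)%R}.
Proof.
move=> r0; apply: continuous_in_subspaceT => x; rewrite inE/= in_itv/= andbT.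
move=> rx; rewrite /continuous_at; apply: cvgV; last exact: exprn_continuous.
by rewrite expf_neq0// gt_eqF// (lt_le_trans r0).
Qed.

Lemma measurable_exprV2 (R : realType) (r : R) : (0 < r)%R ->
  measurable_fun `[r, +oo[ (fun x : R => (x ^- 2)%:E).
Proof.
move=> r0; apply/measurable_EFinP; apply: subspace_continuous_measurable_fun.
  exact: measurable_itv.
exact: within_continuous_exprV2.
Qed.

(** The function [- x^-1] is an antiderivative of [x ^- 2] that vanishes at
    infinity. *)
Lemma integral_pareto_tail (R : realType) (r : R) : (0 < r)%R ->
  \int[lebesgue_measure]_(x in `]r, +oo[) (x ^- 2)%:E = r^-1%:E.
Proof.
move=> r0.
have neq0 x : (r <= x)%R -> (x != 0)%R.
  by move=> rx; rewrite gt_eqF// (lt_le_trans r0).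
rewrite integral_itv_obnd_cbnd; last first.
  apply: measurable_funS (measurable_exprV2 r0) => //.
  by move=> x /=; rewrite !in_itv/= !andbT; exact: ltW.
rewrite (@ge0_continuous_FTC2y _ _ (fun x => - x^-1)%R _ 0%R).
- by rewrite sub0e EFinN oppeK.
- by move=> x rx; rewrite invr_ge0 exprn_ge0// (le_trans (ltW r0)).
- exact: within_continuous_exprV2.
- rewrite -[X in _ --> X]oppr0; apply: cvgN.
  by apply/gtr0_cvgV0; [exact: nbhs_pinfty_gt|exact: cvg_id].
- move=> x /ltW rx; apply: derivableN.
  by apply: derivableV => //; exact: neq0.
- apply: cvgN; apply: cvg_at_right_filter.
  by apply: cvgV => //; exact: neq0.
- move=> x; rewrite in_itv/= andbT => /ltW rx.
  rewrite derive1E deriveN ?deriveV ?neq0//; last first.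
    by apply: derivableV => //; exact: neq0.
  by rewrite derive_id scaleNr opprK /GRing.scale/= mulr1.
Qed.

Definition pareto_density (R : realType) : R -> \bar R :=
  (fun x : R => (x ^- 2)%:E) \_ `[1%R, +oo[.

Lemma pareto_density_ge0 (R : realType) (x : R) : 0 <= pareto_density x.
Proof.
apply: erestrict_ge0 => y /=; rewrite in_itv/= andbT => y1.
by rewrite lee_fin invr_ge0 exprn_ge0// (le_trans ler01).
Qed.

Lemma measurable_pareto_density (R : realType) :
  measurable_fun setT (@pareto_density R).
Proof.
apply/(measurable_restrictT _ (measurable_itv _)).
exact: (measurable_exprV2 ltr01).
Qed.

Section pareto_tail.
Context (d : measure_display) (T : measurableType d) (R : realType).
Variables (P : probability T R) (Y : T -> \bar R).
Hypothesis mY : measurable_fun setT Y.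
Hypothesis Y1 : forall w, 1 <= Y w.
Hypothesis tailY : forall r : R, (1 <= r)%R ->
  P [set w | r%:E <= Y w] <= r^-1%:E.

Let measurable_tail (r : R) : measurable [set w | r%:E <= Y w].
Proof.
by rewrite -[X in measurable X]setTI; exact: emeasurable_fun_c_infty.
Qed.

Let measurable_infinite : measurable [set w | Y w = +oo].
Proof.
by rewrite -[X in measurable X]setTI; exact: (mY _ (emeasurable_set1 +oo)).
Qed.

(** The tail bound gives no mass to infinity, where the Pareto law, which
    lives on the real line, has nothing to compare with. *)
Lemma tail_infinite_eq0 : P [set w | Y w = +oo] = 0.
Proof.
apply/eqP; rewrite eq_le measure_ge0 andbT.
apply/lee_addgt0Pr => e e0; rewrite add0e.
have e1 : (1 <= Num.max 1 e^-1)%R by rewrite le_max lexx.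
apply: (le_trans (y := P [set w | (Num.max 1 e^-1)%:E <= Y w])).
  by apply: le_measure; rewrite ?inE// => w /= ->; rewrite leey.
apply: le_trans (tailY e1) _.
by rewrite lee_fin invf_ple ?posrE// ?le_max ?lexx ?orbT// lt_max ltr01.
Qed.

(** The superlevel set of [B] is an up-set. With [r] the infimum of its part
    above 1, it has probability at most [P (Y >= r) <= r^-1], which is the
    Pareto mass of the interval above [r], and this interval lies in it. *)
Lemma le_pareto_level (B : \bar R -> \bar R) (s : \bar R) :
  {homo B : x y / x <= y} ->
  P [set w | s < B (Y w)] <=
  \int[lebesgue_measure]_(x in [set x : R | s < B x%:E]) pareto_density x.
Proof.
move=> ndB.
have mBY : measurable [set w | s < B (Y w)].
  rewrite -[X in measurable X]setTI.
  exact: (mY measurableT (measurable_monotone_level s ndB)).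
set V := [set y | 1 <= y /\ s < B y].
have m1 : 1 <= ereal_inf V by apply: le_ereal_inf_tmp => y [].
have VY w : s < B (Y w) -> ereal_inf V <= Y w.
  by move=> sBY; apply: ereal_inf_lbound; split.
case E : (ereal_inf V) m1 VY => [r| |//] m1 VY; last first.
  (* No real number reaches the level: only an infinite [Y] can. *)
  apply: (le_trans (y := P [set w | Y w = +oo])); last first.
    rewrite tail_infinite_eq0 integral_ge0// => x _.
    exact: pareto_density_ge0.
  apply: le_measure; rewrite ?inE//.
  by move=> w /VY /=; rewrite leye_eq => /eqP.
rewrite lee_fin in m1.
have r0 : (0 < r)%R := lt_le_trans ltr01 m1.
apply: (le_trans (y := P [set w | r%:E <= Y w])).
  by apply: le_measure; rewrite ?inE.
apply: le_trans (tailY m1) _; rewrite -(integral_pareto_tail r0).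
rewrite integral_mkcond [leRHS]integral_mkcond.
apply: ge0_le_integral_nomeas => x _.
  by apply: erestrict_ge0 => y _; rewrite lee_fin invr_ge0 sqr_ge0.
rewrite patchE; case: ifPn => [|_]; last first.
  by apply: erestrict_ge0 => y _; exact: pareto_density_ge0.
rewrite inE/= in_itv/= andbT => rx.
have x1 : (1 <= x)%R by rewrite (le_trans m1)// ltW.
rewrite patchE mem_set/=.
  by rewrite /pareto_density patchE mem_set//= in_itv/= x1.
have : ereal_inf V < x%:E by rewrite E lte_fin.
move=> /ereal_inf_lt[y [_ sBy] yx]; apply: lt_le_trans sBy _.
exact/ndB/ltW.
Qed.

(** Expectations of nondecreasing functions respect stochastic domination:
    layer by layer, this is the comparison of superlevel sets. *)
Lemma le_expectation_pareto (B : \bar R -> \bar R) :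
  {homo B : x y / x <= y} -> (forall x, 0 <= B x) ->
  \int[P]_w B (Y w) <=
  \int[lebesgue_measure]_(x in `[1%R, +oo[) (B x%:E * (x ^- 2)%:E).
Proof.
move=> ndB B0.
have mB := measurable_monotone ndB.
have mBY := measurableT_comp mB mY.
have mBE := measurableT_comp mB (@EFin_measurable R setT).
rewrite [leLHS](_ : _ = \int[P]_w ((B \o Y) w * cst 1 w)); last first.
  by apply: eq_integral => w _; rewrite /= mule1.
rewrite (weighted_layer_cake _ mBY)//; last by move=> w /=; exact: B0.
rewrite [leRHS]integral_mkcond.
rewrite [leRHS](_ : _ =
  \int[lebesgue_measure]_x ((B \o EFin) x * pareto_density x)); last first.
  apply: eq_integral => x _; rewrite /pareto_density !patchE.
  by case: ifPn; rewrite ?mule0.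
rewrite [leRHS](weighted_layer_cake lebesgue_measure mBE)//=; last 2 first.
- exact: measurable_pareto_density.
- exact: pareto_density_ge0.
apply: ge0_le_integral_nomeas => s; first by move=> _; exact: integral_ge0.
move=> _; apply: le_trans (le_pareto_level _ ndB).
rewrite integral_cst ?mul1e//.
by rewrite -[X in measurable X]setTI; exact: emeasurable_fun_o_infty.
Qed.

End pareto_tail.

End pareto.

(** * Closed eBH and eBH *)

Section closed_eBH_theory.
Context (R : realType) (m : nat) (alpha : R).
Hypothesis alpha0 : 0 < alpha.
Implicit Types (e : 'I_m -> \bar R) (S D : {set 'I_m}).
Local Open Scope ereal_scope.

Lemma measurable_avg_evalue (d : measure_display) (T : measurableType d)
    (Z : 'I_m -> T -> \bar R) (S : {set 'I_m}) :
  (forall i, measurable_fun setT (Z i)) ->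
  measurable_fun setT (fun w => avg_evalue (Z ^~ w) S).
Proof.
move=> mZ; rewrite /avg_evalue; apply: measurable_funeM.
by under eq_fun do rewrite -big_enum; exact: emeasurable_sum.
Qed.

Lemma le_avg_evalue e e' S : (forall i, e i <= e' i) ->
  avg_evalue e S <= avg_evalue e' S.
Proof.
move=> ee'; apply: lee_wpmul2l; first by rewrite lee_fin invr_ge0.
by apply: lee_sum => i _.
Qed.

Lemma avg_evalue_ge0 e S : (forall i, 0 <= e i) -> 0 <= avg_evalue e S.
Proof.
move=> e0; rewrite mule_ge0 ?lee_fin ?invr_ge0//.
by apply: sume_ge0 => i _.
Qed.

(** The defining inequality of closed eBH also covers the empty set, where both
    sides vanish, so one bound serves for every set of true nulls. *)
Lemma FDP_closed_eBH e S D : D \in closed_eBH alpha e ->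
  (FDP S D)%:E <= alpha%:E * avg_evalue e S.
Proof.
rewrite inE => /forallP/(_ S)/implyP DC.
have [->|/DC//] := eqVneq S finset.set0.
by rewrite /FDP /avg_evalue finset.set0I cards0 mul0r big_set0 !mule0.
Qed.

Lemma closed_eBH_mono e e' : (forall i, e i <= e' i) ->
  closed_eBH alpha e \subset closed_eBH alpha e'.
Proof.
move=> ee'; apply/fintype.subsetP => D De; rewrite inE; apply/forallP => S.
apply/implyP => _; apply: le_trans (FDP_closed_eBH S De) _.
by apply: lee_wpmul2l; [rewrite lee_fin ltW|exact: le_avg_evalue].
Qed.

(** A maximum of indices satisfying a condition satisfies it too, unless the
    range is empty. *)
Lemma eBH_countP e :
  (eBH_count alpha e <= m)%N /\
  (eBH_count alpha e = 0%N \/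
   (alpha^-1)%:E <= ((eBH_count alpha e)%:R / m%:R)%:E *
     kth_largest e (eBH_count alpha e)).
Proof.
rewrite /eBH_count; apply: (big_ind (fun k => (k <= m)%N /\ (k = 0%N \/
    (alpha^-1)%:E <= (k%:R / m%:R)%:E * kth_largest e k))).
- by split=> //; left.
- by move=> j k Kj Kk; rewrite /maxn; case: ifP.
- by move=> k /andP[_ ?]; split; [rewrite -ltnS|right].
Qed.

Let ranking e : seq 'I_m := sort (fun i j => e j <= e i) (enum 'I_m).

Let size_ranking e : size (ranking e) = m.
Proof. by rewrite size_sort size_enum_ord. Qed.

Lemma card_eBH e : #|eBH alpha e| = eBH_count alpha e.
Proof.
rewrite cardsE (card_uniqP _) ?size_take ?size_ranking; last first.
  by rewrite take_uniq// sort_uniq enum_uniq.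
by case: ltngtP (eBH_countP e).1.
Qed.

(** Sorting the indices by value and then reading the values gives the sorted
    values, so an index among the first [k] carries a value at least the
    [k]-th. *)
Lemma kth_largest_le_eBH e i : i \in eBH alpha e ->
  kth_largest e (eBH_count alpha e) <= e i.
Proof.
set k := eBH_count _ _; rewrite inE -/(ranking e) -/k => ik.
have km : (k <= m)%N := (eBH_countP e).1.
have k0 : (0 < k)%N by case: (k) ik => //; rewrite take0.
have sz : size (map e (ranking e)) = m by rewrite size_map size_ranking.
have -> : kth_largest e k = nth 0 (map e (ranking e)) k.-1.
  by rewrite /kth_largest sort_map.
have si : (index i (ranking e) < k)%N.
  rewrite -(cat_take_drop k (ranking e)) index_cat ik.
  apply: leq_trans (_ : size (take k (ranking e)) <= _)%N.
    by rewrite index_mem.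
  by rewrite size_take size_ranking; case: ifP => // /negbT; rewrite -leqNgt.
have iR : i \in ranking e by exact: mem_take ik.
have -> : e i = nth 0 (map e (ranking e)) (index i (ranking e)).
  by rewrite (nth_map i) ?nth_index// index_mem.
have sorted_e : sorted (fun x y : \bar R => y <= x) (map e (ranking e)).
  rewrite sorted_map; apply: sort_sorted => j j'; exact: le_total.
have tr : transitive (fun x y : \bar R => y <= x).
  by move=> y x z xy yz; exact: le_trans yz xy.
apply: (sorted_leq_nth tr _ 0 sorted_e) => //.
- by rewrite inE sz (leq_trans si).
- by rewrite inE sz prednK.
- by rewrite -ltnS prednK.
Qed.

Lemma eBH_in_closed_eBH e : (forall i, 0 <= e i) ->
  eBH alpha e \in closed_eBH alpha e.
Proof.
move=> e0; rewrite inE; apply/forallP => S; apply/implyP => S0.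
set D := eBH alpha e; set k := eBH_count alpha e.
have cardD : #|D| = k by exact: card_eBH.
have [km kP] := eBH_countP e; rewrite -/k in km kP.
have [k0|k0] := posnP k.
  have -> : D = finset.set0 by apply: cards0_eq; rewrite cardD.
  rewrite /FDP finset.setI0 cards0 mul0r mule_ge0//.
    by rewrite lee_fin ltW.
  exact: avg_evalue_ge0.
case: kP => [k_eq0|kP]; first by rewrite k_eq0 in k0.
have m0 : (0 < m)%N by exact: leq_trans km.
have S0' : (0 < #|S|)%N by rewrite card_gt0.
have Sm : (#|S| <= m)%N by rewrite (leq_trans (max_card _))// card_ord.
(* The least value that the threshold condition allows: [m / (k alpha)]. *)
pose v : R := ((k%:R / m%:R)^-1 * alpha^-1)%R.
have ve i : i \in D -> v%:E <= e i.
  move=> iD; apply: le_trans (kth_largest_le_eBH iD).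
  by rewrite EFinM lee_pdivrMl// divr_gt0// ltr0n.
have sum_ge : (#|S :&: D|%:R * v)%:E <= \sum_(i in S) e i.
  apply: (le_trans (y := \sum_(i in S) (if i \in D then v else 0)%:E)).
    rewrite sumEFin -big_mkcondr/= sumr_const mulr_natl lee_fin.
    by rewrite (_ : #|S :&: D| = #|[pred i | (i \in S) && (i \in D)]|)//;
      apply: eq_card => i; rewrite inE.
  apply: lee_sum => i _; case: ifP => [/ve//|_]; exact: e0.
apply: le_trans (_ : (alpha * (#|S|%:R^-1 * (#|S :&: D|%:R * v)))%:E <= _).
  rewrite lee_fin /FDP cardD (maxn_idPl k0).
  rewrite (_ : (alpha * _ = #|S :&: D|%:R / k%:R * (m%:R / #|S|%:R))%R).
    by rewrite ler_peMr// ler_pdivlMr ?ltr0n// mul1r ler_nat.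
  by rewrite /v; field; rewrite !pnatr_eq0 -!lt0n k0 m0 S0' gt_eqF.
rewrite EFinM EFinM; apply: lee_wpmul2l; first by rewrite lee_fin ltW.
by apply: lee_wpmul2l => //; rewrite lee_fin invr_ge0.
Qed.

Lemma max_FDP_closed_eBH_le e S (y : \bar R) : 0 <= y ->
  alpha%:E * avg_evalue e S <= y ->
  (max_FDP S (closed_eBH alpha e))%:E <= y.
Proof.
move=> y0 ey; apply: (big_ind (fun x : R => x%:E <= y)) => //.
  by move=> a b ay by'; rewrite EFin_max ge_max ay.
by move=> D De; exact: le_trans (FDP_closed_eBH S De) ey.
Qed.

End closed_eBH_theory.

(** * Adjusted running suprema *)

Section adjusted_processes.
Local Open Scope ereal_scope.
Context (R : realType) (A : \bar R -> \bar R).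
Hypothesis hA : adjuster A.

(** Precomposing [A] with the truncation at 1 makes it nondecreasing on the
    whole extended line, which gives its measurability. *)
Let adj1 (x : \bar R) := A (maxe 1 x).

Let adj1_ge0 x : 0 <= adj1 x.
Proof. by case: hA => A0 _ _; apply: A0; rewrite le_max lexx. Qed.

Let adj1_homo : {homo adj1 : x y / x <= y}.
Proof.
case: hA => _ ndA _ x y xy; apply: ndA; first by rewrite le_max lexx.
by rewrite ge_max le_max lexx/= le_max xy orbT.
Qed.

Lemma adjusted_ge0 (T : Type) (E : nat -> T -> \bar R) t w :
  0 <= adjusted A E t w.
Proof. exact: adj1_ge0. Qed.

Lemma adjusted_homo (T : Type) (E : nat -> T -> \bar R) t u w :
  (t <= u)%N -> adjusted A E t w <= adjusted A E u w.
Proof.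
move=> tu; apply: adj1_homo; apply: ereal_sup_le => _ [s st <-].
by exists s => //; exact: leq_trans st tu.
Qed.

Lemma adjusted_le_sup (T : Type) (E : nat -> T -> \bar R) t w :
  adjusted A E t w <= A (maxe 1 (ereal_sup (range (E ^~ w)))).
Proof.
by apply: adj1_homo; apply: ereal_sup_le => _ [s st <-]; exists s.
Qed.

Context (d : measure_display) (T : measurableType d).
Variables (F : nat -> set (set T)) (H : set (probability T R)).
Variable E : nat -> T -> \bar R.
Hypothesis hF : filtration F.
Hypothesis hE : e_process F H E.

Lemma measurable_adjusted_sup :
  measurable_fun setT (fun w => A (maxe 1 (ereal_sup (range (E ^~ w))))).
Proof.
exact: measurableT_comp (measurable_monotone adj1_homo)
  (measurable_sup_e_process hF hE).
Qed.

(** By Ville's inequality the running supremum, truncated below at 1, is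
    dominated by the Pareto law. *)
Lemma expectation_adjusted_sup_le1 (P : probability T R) : H P ->
  \int[P]_w A (maxe 1 (ereal_sup (range (E ^~ w)))) <= 1.
Proof.
move=> HP; pose Y w := maxe 1 (ereal_sup (range (E ^~ w))).
have mY : measurable_fun setT Y.
  by apply: measurable_maxe => //; exact: (measurable_sup_e_process hF hE).
have Y1 w : 1 <= Y w by rewrite le_max lexx.
have tailY (r : R) : (1 <= r)%R -> P [set w | r%:E <= Y w] <= r^-1%:E.
  rewrite le_eqVlt => /predU1P[<-|r1].
    rewrite invr1 probability_le1// -[X in measurable X]setTI.
    exact: emeasurable_fun_c_infty.
  rewrite (_ : [set w | _] = [set w | r%:E <= ereal_sup (range (E ^~ w))]).
    exact: (ville hF hE HP (lt_trans ltr01 r1)).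
  by apply/seteqP; split=> w /=; rewrite le_max lee_fin [(r <= 1)%R]leNgt r1.
case: (hA) => _ _; apply: le_trans.
have -> : \int[P]_w A (maxe 1 (ereal_sup (range (E ^~ w)))) =
    \int[P]_w adj1 (Y w).
  by apply: eq_integral => w _; rewrite /adj1 maxA maxxx.
apply: le_trans (le_expectation_pareto mY Y1 tailY adj1_homo adj1_ge0) _.
apply: ge0_le_integral_nomeas => x; rewrite /= in_itv/= andbT => x1.
  by rewrite mule_ge0// lee_fin invr_ge0 exprn_ge0// (le_trans ler01).
by rewrite /adj1 (max_idPr _)// lee_fin.
Qed.

End adjusted_processes.

(** * Simultaneous control *)

Section SupFDR.
Local Open Scope ereal_scope.
Context (R : realType) (d : measure_display) (T : measurableType d).

Lemma expectation_avg_evalue_le1 (m : nat) (P : probability T R)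
    (Z : 'I_m -> T -> \bar R) (S : {set 'I_m}) :
  (forall i, measurable_fun setT (Z i)) -> (forall i w, 0 <= Z i w) ->
  (forall i, i \in S -> \int[P]_w Z i w <= 1) ->
  \int[P]_w avg_evalue (Z ^~ w) S <= 1.
Proof.
move=> mZ Z0 EZ; rewrite /avg_evalue.
under eq_integral do rewrite -big_enum.
rewrite ge0_integralZl_EFin//; last 2 first.
- by move=> w _; apply: sume_ge0 => i _.
- exact: emeasurable_sum.
rewrite ge0_integral_sum// big_enum/=.
have [->|S0] := eqVneq S finset.set0; first by rewrite big_set0 mule0.
rewrite lee_pdivrMl ?ltr0n ?card_gt0// mule1.
apply: le_trans (_ : \sum_(i in S) 1 <= _); first exact: lee_sum.
by rewrite sumEFin sumr_const.
Qed.

End SupFDR.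

Theorem corollary6p2 (R : realType) (d : measure_display)
    (T : measurableType d) (F : nat -> set (set T))
    (hF : filtration F)
    (M : set (probability T R)) (m : nat)
    (H : 'I_m -> set (probability T R)) (hH : forall i, H i `<=` M)
    (alpha : R) (halpha0 : 0 < alpha) (halpha1 : alpha <= 1)
    (E : 'I_m -> nat -> T -> \bar R)
    (hE : forall i, e_process F (H i) (E i))
    (A : \bar R -> \bar R) (hA : adjuster A) :
  let e := fun (t : nat) (w : T) (i : 'I_m) => adjusted A (E i) t w in
  let C := fun (t : nat) (w : T) => closed_eBH alpha (e t w) in
  [/\ setwise_persistent C,
      forall P : probability T R, M P ->
        (simultaneous_SupFDR H C P <= alpha%:E)%E
    & forall (t : nat) (w : T), eBH alpha (e t w) \in C t w].
Proof.
move=> e C; split=> [w t u tu|P _|t w].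
- by apply: closed_eBH_mono => // i; exact: adjusted_homo.
- pose Z i w := A (maxe 1%E (ereal_sup (range (E i ^~ w)))).
  have Z0 i w : (0 <= Z i w)%E by case: hA => A0 _ _; rewrite A0// le_max lexx.
  have mZ i : measurable_fun setT (Z i).
    exact: (measurable_adjusted_sup hA hF (hE i)).
  have ZE : (\int[P]_w avg_evalue (Z ^~ w) (true_nulls H P) <= 1)%E.
    apply: expectation_avg_evalue_le1 => // i; rewrite inE => /asboolP HiP.
    exact: (expectation_adjusted_sup_le1 hA hF (hE i)).
  apply: (@le_trans _ _
    (\int[P]_w (alpha%:E * avg_evalue (Z ^~ w) (true_nulls H P)))%E).
    (* The average of the time-suprema bounds the FDP at every time. *)
    apply: ge0_le_integral_nomeas => w _.
      apply: le_ereal_sup_tmp; eexists; first by exists 0%N.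
      by rewrite lee_fin; apply: bigmax_ge_id.
    apply: ge_ereal_sup => _ [t _ <-].
    apply: max_FDP_closed_eBH_le => //.
      by rewrite mule_ge0 ?lee_fin ?(ltW halpha0)// avg_evalue_ge0.
    apply: lee_wpmul2l; first by rewrite lee_fin ltW.
    by apply: le_avg_evalue => i; exact: adjusted_le_sup.
  rewrite ge0_integralZl_EFin//; last 3 first.
  - by move=> w _; exact: avg_evalue_ge0.
  - exact: measurable_avg_evalue.
  - exact: ltW.
  by rewrite -[leRHS]mule1 lee_pmul2l.
- by apply: eBH_in_closed_eBH => // i; exact: adjusted_ge0.
Qed.
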